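(* Let $n\ge1$ and let $\mathcal{F}$ be the set of distributions of $(X_1,\dots,X_n)$ with given supports $[0,b_i]$, means $\mu_i$ and mean absolute deviations $d_i$ (no assumption on dependence). Put $\bar\mu=\sum_{i=1}^n\mu_i$ and $\bar b=\sum_{i=1}^n b_i$. Suppose $\hat d$ satisfies $$\mathbb{E}_{\mathbb{P}}\Big[\Big|\sum_{i=1}^n X_i-\bar\mu\Big|\Big]\le\hat d\quad\text{for all }\mathbb{P}\in\mathcal{F}.$$ Then $$\sup_{\mathbb{P}\in\mathcal{F}}\mathbb{P}\Big(\sum_{i=1}^n X_i\ge t\Big)\le\begin{cases}1, & \text{if } t\le\bar\mu,\\ \min\Big\{\frac{\hat d}{2(t-\bar\mu)},\ \frac{\bar\mu}{t}\Big\}, & \text{if } t\in(\bar\mu,\bar b].\end{cases}$$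
   Context: $\mathcal{F}$ is the set of all probability measures $\mathbb{P}$ on the Borel $\sigma$-algebra of $\mathbb{R}^n$ (joint distributions of $(X_1,\dots,X_n)$) such that for each $i=1,\dots,n$: $\mathbb{P}(X_i\in[0,b_i])=1$, $\mathbb{E}_{\mathbb{P}}[X_i]=\mu_i$ and $\mathbb{E}_{\mathbb{P}}[|X_i-\mu_i|]=d_i$, where $0<\mu_i<b_i$ and $d_i\ge 0$ are given and $\mathcal{F}$ is nonempty. *)

(* Defs.v *)
From mathcomp Require Import all_boot all_order all_algebra.
From mathcomp Require Import all_classical all_reals all_analysis.

Set Implicit Arguments.
Unset Strict Implicit.
Unset Printing Implicit Defensive.

Import Order.TTheory GRing.Theory Num.Theory.
Import numFieldNormedType.Exports.

Local Open Scope classical_set_scope.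
Local Open Scope ring_scope.

(* R^n (as row vectors) with the Borel sigma-algebra, i.e. the one generated
   by the open sets of the canonical topology of 'rV[R]_n. *)
Notation borel_rV R n := (g_sigma_algebraType (@open 'rV[R]_n)).

Definition coord_rv (R : realType) (n : nat) (i : 'I_n) : borel_rV R n -> R :=
  fun x => (x : 'rV[R]_n) ord0 i.

Definition sum_rv (R : realType) (n : nat) : borel_rV R n -> R :=
  fun x => \sum_(i < n) coord_rv i x.

Definition ambiguity_set (R : realType) (n : nat) (b mu d : 'I_n -> R) :
    set (probability (borel_rV R n) R) :=
  [set P : probability (borel_rV R n) R | forall i : 'I_n,
    [/\ P (coord_rv i @^-1` `[0, b i]) = 1%E,
        'E_P[coord_rv i]%E = (mu i)%:E &
        'E_P[fun x => (`|coord_rv i x - mu i|)%R]%E = (d i)%:E]].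

(* Main.v *)
Require Import Defs.
From mathcomp Require Import all_boot all_order all_algebra.
From mathcomp Require Import all_classical all_reals all_analysis.
From mathcomp Require Import measurable_realfun.
From mathcomp Require Import lra.

(** Write [S] for the sum of the coordinates and [m] for the sum of the means.
    Each coordinate takes values in a bounded interval almost surely, hence is
    integrable, so [S] is integrable and [E S = m] whatever the dependence
    between the coordinates ([expectation_sum_rv]).

    Both tail bounds are instances of one domination principle
    ([ae_domination_bound]): if [c * 1_A <= Y] almost surely, then
    [c * P A <= E Y].  Take [A] to be the event [t <= S].

    - As [S >= 0] almost surely, [t * 1_A <= S]; this is Markov's inequality
      and gives [t * P A <= m].
    - The function [|S - m| + (S - m)] is twice the positive part of [S - m]:
      it is nonnegative, and at least [2 * (t - m)] on [A].  Its second summand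
      is centred, so its expectation is [E |S - m| <= dhat], and
      [2 * (t - m) * P A <= dhat].  Centring is what gains the factor [2] over
      Markov's inequality applied to [|S - m|].

    The bounds are uniform in the distribution, so they hold for the supremum. *)

Set Implicit Arguments.
Unset Strict Implicit.
Unset Printing Implicit Defensive.

Import Order.TTheory GRing.Theory Num.Theory.
Import numFieldNormedType.Exports.

Local Open Scope classical_set_scope.
Local Open Scope ring_scope.

Lemma ae_bounded_Lfun1 d (T : measurableType d) (R : realType)
    (P : probability T R) (X : T -> R) (M : R) :
  measurable_fun setT X -> {ae P, forall x, `|X x| <= M} -> X \in Lfun P 1.
Proof.
move=> mX XM; apply/Lfun1_integrable/integrableP; split.
  exact/measurable_EFinP.
apply: (@le_lt_trans _ _ (\int[P]_x (cst `|M|%:E x))%E).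
  apply: ae_ge0_le_integral => //.
  - by apply/measurable_EFinP; exact: measurableT_comp.
  - by move=> x _; rewrite /= lee_fin.
  - by apply: filterS XM => x XM _; rewrite /= lee_fin (le_trans XM)// ler_norm.
by rewrite integral_cst//= probability_setT mule1 ltry.
Qed.

(** Almost surely [Y] is its own absolute value, which dominates [c * 1_A]
    and to which monotonicity of nonnegative integrals applies. *)
Lemma ae_domination_bound d (T : measurableType d) (R : realType)
    (P : probability T R) (A : set T) (Y : T -> R) (c : R) :
  measurable A -> measurable_fun setT Y -> 0 <= c ->
  {ae P, forall x, c * \1_A x <= Y x} -> (c%:E * P A <= 'E_P[Y])%E.
Proof.
move=> mA mY c0 cAY.
have cA0 x : 0 <= c * \1_A x by rewrite mulr_ge0.
have -> : 'E_P[Y]%E = 'E_P[fun x => `|Y x|%R]%E.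
  rewrite unlock; apply: ae_eq_integral => //.
  - exact/measurable_EFinP.
  - by apply/measurable_EFinP; exact: measurableT_comp.
  - by apply: filterS cAY => x cAYx _; rewrite ger0_norm// (le_trans (cA0 x)).
have -> : (c%:E * P A = 'E_P[fun x => (c * \1_A x)%R])%E.
  rewrite unlock; under eq_integral do rewrite EFinM.
  rewrite ge0_integralZl_EFin//; last first.
    by apply/measurable_EFinP; exact: measurable_indic.
  by rewrite integral_indic// setIT.
apply: expectation_le => //.
- by apply: measurable_funM => //; exact: measurable_indic.
- exact: measurableT_comp.
- by apply: filterS cAY => x cAYx; rewrite (le_trans cAYx)// ler_norm.
Qed.

Section SumOfCoordinates.
Variables (R : realType) (n : nat).

(** Coordinates are continuous, so preimages of open intervals are open. *)
Lemma measurable_coord_rv (i : 'I_n) :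
  measurable_fun setT (@coord_rv R n i).
Proof.
apply: (measurability _ (RGenOpens.measurableE R)).
move=> _ [_ [a [b ->] <-]]; rewrite setTI; apply: sub_sigma_algebra.
have /continuousP := @coord_continuous R 1 n ord0 i.
by apply; exact: interval_open.
Qed.

Lemma measurable_sum_rv : measurable_fun setT (@sum_rv R n).
Proof. by apply: measurable_sum => i; exact: measurable_coord_rv. Qed.

Variables (b mu d : 'I_n -> R) (P : probability (borel_rV R n) R).
Hypothesis FP : ambiguity_set b mu d P.

Lemma ae_coord_rv_itv (i : 'I_n) : {ae P, forall x, 0 <= coord_rv i x <= b i}.
Proof.
have [Pi _ _] := FP i.
have mI : measurable (coord_rv i @^-1` `[0, b i]).
  by rewrite -[X in measurable X]setTI; exact: measurable_coord_rv.
exists (~` (coord_rv i @^-1` `[0, b i])); split.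
- exact: measurableC.
- by rewrite /= probability_setC// Pi subee.
- by apply: subsetC => x /=; rewrite in_itv.
Qed.

Lemma coord_rv_Lfun1 (i : 'I_n) : coord_rv i \in Lfun P 1.
Proof.
apply: (@ae_bounded_Lfun1 _ _ _ _ _ (b i)); first exact: measurable_coord_rv.
by apply: filterS (ae_coord_rv_itv i) => x /andP[x0 xb]; rewrite ger0_norm.
Qed.

Lemma ae_sum_rv_ge0 : {ae P, forall x, 0 <= sum_rv x}.
Proof.
have : {ae P, forall x, forall i : 'I_n, 0 <= coord_rv i x}.
  apply: filter_forall => i.
  by apply: filterS (ae_coord_rv_itv i) => x /andP[].
by apply: filterS => x x0; exact: sumr_ge0.
Qed.

Lemma integrable_sum_rv : P.-integrable setT (EFin \o @sum_rv R n).
Proof.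
rewrite (_ : _ \o _ = fun x => \sum_(i < n) (coord_rv i x)%:E)%E.
  by apply: integrable_sum => // i _; exact/Lfun1_integrable/coord_rv_Lfun1.
by apply/funext => x /=; rewrite sumEFin.
Qed.

Lemma expectation_sum_rv : 'E_P[@sum_rv R n]%E = (\sum_(i < n) mu i)%:E.
Proof.
rewrite unlock; under eq_integral do rewrite -sumEFin.
rewrite integral_sum//.
  by rewrite -sumEFin; apply: eq_bigr => i _; have [_ <- _] := FP i; rewrite unlock.
by move=> i; exact/Lfun1_integrable/coord_rv_Lfun1.
Qed.

Lemma centred_sum_rv_Lfun1 (m : R) :
  (fun x : borel_rV R n => sum_rv x - m) \in Lfun P 1.
Proof.
apply: (rpredB (x := @sum_rv R n) (y := cst m)); last exact: Lfun_cst.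
exact/Lfun1_integrable/integrable_sum_rv.
Qed.

Lemma expectation_centred_sum_rv :
  'E_P[fun x => (sum_rv x - \sum_(i < n) mu i)%R]%E = 0%E.
Proof.
rewrite (expectationB (Y := cst _)) ?expectation_sum_rv ?expectation_cst ?subee//.
- exact/Lfun1_integrable/integrable_sum_rv.
- exact: Lfun_cst.
Qed.

Lemma measurable_sum_rv_tail (t : R) :
  measurable [set x : borel_rV R n | t <= sum_rv x].
Proof.
rewrite (_ : mkset _ = @sum_rv R n @^-1` `[t, +oo[).
  by rewrite -[X in measurable X]setTI; exact: measurable_sum_rv.
by apply/seteqP; split => x /=; rewrite in_itv/= andbT.
Qed.

Lemma sum_rv_markov (t : R) : 0 < t ->
  (P [set x | (t <= sum_rv x)%R] <= ((\sum_(i < n) mu i) / t)%:E)%E.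
Proof.
move=> t0; rewrite EFinM lee_pdivlMr// muleC -expectation_sum_rv.
apply: ae_domination_bound (ltW t0) _.
- exact: measurable_sum_rv_tail.
- exact: measurable_sum_rv.
apply: filterS ae_sum_rv_ge0 => x x0; rewrite indicE.
by case: (boolP (x \in _)) => [/set_mem/=|_]; rewrite ?mulr1 ?mulr0.
Qed.

(** The random variable [|S - m| + (S - m)] is nonnegative, is at least
    [2 * (t - m)] where [t <= S], and has the same mean as [|S - m|]. *)
Lemma sum_rv_mad_tail (dhat t : R) : \sum_(i < n) mu i < t ->
  ('E_P[fun x => `|sum_rv x - \sum_(i < n) mu i|%R] <= dhat%:E)%E ->
  (P [set x | (t <= sum_rv x)%R] <=
     (dhat / (2 * (t - \sum_(i < n) mu i)))%:E)%E.
Proof.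
set m := \sum_(i < n) mu i => mt hdhat.
have c0 : 0 < 2 * (t - m) by lra.
have mSm : measurable_fun setT (fun x : borel_rV R n => sum_rv x - m).
  by apply: measurable_funB => //; exact: measurable_sum_rv.
have iSm := centred_sum_rv_Lfun1 m.
rewrite EFinM lee_pdivlMr// muleC; apply: le_trans hdhat.
have <- : 'E_P[fun x => (`|sum_rv x - m| + (sum_rv x - m))%R]%E
          = 'E_P[fun x => `|sum_rv x - m|%R]%E.
  rewrite (expectationD (Lfun_norm iSm) iSm).
  by rewrite expectation_centred_sum_rv adde0.
apply: ae_domination_bound (ltW c0) _.
- exact: measurable_sum_rv_tail.
- by apply: measurable_funD => //; exact: measurableT_comp.
apply: aeW => x; rewrite indicE.
(* On [A] the left side is [2 * (t - m)] and the right one is [2 * (S - m)];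
   off [A] the claim is [- (S - m) <= `|S - m|]. *)
have SmN : - (sum_rv x - m) <= `|sum_rv x - m| by rewrite -normrN ler_norm.
have Sm : sum_rv x - m <= `|sum_rv x - m| by rewrite ler_norm.
by case: (boolP (x \in _)) => [/set_mem/= tS|_]; rewrite ?mulr1 ?mulr0; lra.
Qed.

End SumOfCoordinates.

Theorem theorem8 (R : realType) (n : nat) (hn : (1 <= n)%N)
    (b mu d : 'I_n -> R)
    (hmu : forall i, 0 < mu i < b i)
    (hd : forall i, 0 <= d i)
    (hF : ambiguity_set b mu d !=set0)
    (dhat : R)
    (hdhat : forall P : probability (borel_rV R n) R, ambiguity_set b mu d P ->
      ('E_P[fun x => (`|sum_rv x - \sum_(i < n) mu i|)%R] <= dhat%:E)%E)
    (t : R) :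
  let mubar := \sum_(i < n) mu i in
  let bbar := \sum_(i < n) b i in
  let supP := ereal_sup [set P [set x | t <= sum_rv x]
                        | P in ambiguity_set b mu d] in
  (t <= mubar -> (supP <= 1%:E)%E) /\
  (mubar < t <= bbar ->
    (supP <= (Num.min (dhat / (2 * (t - mubar))) (mubar / t))%:E)%E).
Proof.
move=> mubar bbar supP; split=> [_|/andP[mt _]]; apply: ge_ereal_sup => _ [P FP <-].
  by apply: probability_le1; exact: measurable_sum_rv_tail.
have t0 : 0 < t.
  by apply: le_lt_trans mt; apply: sumr_ge0 => i _; case/andP: (hmu i) => /ltW.
rewrite EFin_min le_min; apply/andP; split.
- exact: (sum_rv_mad_tail FP mt (hdhat P FP)).
- exact: (sum_rv_markov FP t0).
Qed.
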